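(* Let $0\leq r_1\leq \frac{r_2}{2}$ and let $T$ be a metric tree with $|T|\leq 2(r_1+r_2)$. Then $(r_1,r_2)$ is a cover of $T$.
   Context: A metric tree $T$ is obtained from a finite tree with at least one vertex by replacing each edge by a closed real interval of positive length whose endpoints are identified with the end vertices of the edge; $|T|$ denotes the sum of the lengths of these intervals, and $d_T$ is the path-length metric on $T$. For $v\in T$ and $r\ge 0$, $B_T(v,r)=\{u\in T: d_T(v,u)\leq r\}$. A finite sequence $(r_1,\dots,r_m)$ of non-negative reals is a cover of $T$ if there exist $v_1,\dots,v_m\in T$ with $T=\bigcup_{i=1}^m B_T(v_i,r_i)$. *)

(* Defs.v *)
From mathcomp Require Import all_boot all_order all_algebra.
From mathcomp Require Import all_classical all_reals.

Set Implicit Arguments.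
Unset Strict Implicit.
Unset Printing Implicit Defensive.

Import Order.TTheory GRing.Theory Num.Theory.

Local Open Scope classical_set_scope.
Local Open Scope ring_scope.

(* A nonempty simple graph that is connected and has no cycle on three or more
   vertices; a [ucycle] of size 2 only runs back and forth along one edge. *)
Definition is_tree (V : finType) (adj : rel V) : Prop :=
  [/\ (0 < #|V|)%N,
      symmetric adj,
      irreflexive adj,
      forall x y : V, connect adj x y
    & forall c : seq V, ucycle adj c -> (size c <= 2)%N].

(* Each unordered edge {x, y} is represented once, by the pair listing its end
   vertices in enumeration order; this only fixes which end vertex is glued to
   the endpoint 0 of the interval replacing the edge. *)
Definition tree_edge (V : finType) (adj : rel V) : finType :=
  {xy : V * V | adj xy.1 xy.2 && (enum_rank xy.1 < enum_rank xy.2)%N}.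

Record metric_tree (R : realType) := MetricTree {
  mt_vertex : finType;
  mt_adj : rel mt_vertex;
  mt_is_tree : is_tree mt_adj;
  mt_len : tree_edge mt_adj -> R;
  mt_len_gt0 : forall e : tree_edge mt_adj, 0 < mt_len e
}.

Definition mt_edge (R : realType) (T : metric_tree R) : finType :=
  tree_edge (@mt_adj R T).

Definition mt_src (R : realType) (T : metric_tree R) (e : mt_edge T) :
  mt_vertex T := (val e).1.

Definition mt_tgt (R : realType) (T : metric_tree R) (e : mt_edge T) :
  mt_vertex T := (val e).2.

Definition mt_size (R : realType) (T : metric_tree R) : R :=
  \sum_(e : mt_edge T) mt_len e.

(* The points of the space obtained by gluing, to the vertices, the interval
   [0, mt_len e] of every edge e at its two endpoints: a glued point is either
   a vertex or an interior point of exactly one of the intervals. *)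
Inductive mt_point (R : realType) (T : metric_tree R) : Type :=
| Vertex of mt_vertex T
| Inner (e : mt_edge T) (t : R) of 0 < t < mt_len e.

(* [on_edge e t p]: the element t of the interval [0, mt_len e] is glued to the
   point p of T. *)
Definition on_edge (R : realType) (T : metric_tree R) (e : mt_edge T) (t : R)
    (p : mt_point T) : Prop :=
  match p with
  | Vertex v => (v = mt_src e /\ t = 0) \/ (v = mt_tgt e /\ t = mt_len e)
  | Inner e' s _ => e' = e /\ s = t
  end.

(* [path_length p q l]: some piecewise linear path from p to q, i.e. a finite
   concatenation of segments each inside the interval of one edge, has
   length l. *)
Inductive path_length (R : realType) (T : metric_tree R) :
    mt_point T -> mt_point T -> R -> Prop :=
| path_nil (p : mt_point T) : path_length p p 0
| path_cons (p q z : mt_point T) (e : mt_edge T) (s t l : R) :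
    on_edge e s p -> on_edge e t q -> path_length q z l ->
    path_length p z (`|s - t| + l).

Definition mt_dist (R : realType) (T : metric_tree R) (p q : mt_point T) : R :=
  inf [set l : R | path_length p q l].

Definition mt_ball (R : realType) (T : metric_tree R) (v : mt_point T) (r : R) :
  set (mt_point T) := [set u | mt_dist v u <= r].

Definition is_cover (R : realType) (T : metric_tree R) (rs : seq R) : Prop :=
  (forall r : R, r \in rs -> 0 <= r) /\
  exists v : 'I_(size rs) -> mt_point T,
    [set: mt_point T] = \bigcup_(i in [set: 'I_(size rs)]) mt_ball (v i) rs`_i.

(* Main.v *)
Require Import Defs.
From mathcomp Require Import all_boot all_order all_algebra.
From mathcomp Require Import all_classical all_reals.
From mathcomp Require Import lra.

Set Implicit Arguments.
Unset Strict Implicit.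
Unset Printing Implicit Defensive.

Import Order.TTheory GRing.Theory Num.Theory.

Local Open Scope classical_set_scope.
Local Open Scope ring_scope.

(* Projecting onto the edges embeds the tree isometrically into l1: the distance
   is the sum over all edges of the differences of the projections. Let [p q] be
   a diametral pair, at distance D. If D <= 2 r2, the ball of radius r2 at the
   midpoint of the geodesic from p to q covers the tree. Otherwise place
   the centres on that geodesic, at distance r2 from one end and r1 from the
   other. A point u is then missed only if d(p,u) > 2 r2 and d(q,u) > 2 r1, and
   for the mirrored placement a missed point v has d(q,v) > 2 r2 and
   d(p,v) > 2 r1. If u and v branch off the geodesic at different points, the
   subtree spanned by p, q, u, v has length
   (d(p,u) + d(q,u) + d(p,v) + d(q,v)) / 2 > 2 (r1 + r2). If they branch off at
   the same point, the farther of the two, say u, has both distances > 2 r2, and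
   p, q, u span a subtree of length (D + d(p,u) + d(q,u)) / 2 > 3 r2. *)

(** * Inequalities on the real line *)

Local Ltac abs_lra :=
  repeat match goal with H : context [Num.norm _] |- _ => move: H end;
  repeat match goal with |- context [Num.norm ?x] => case: (ger0P x) => ? end;
  intros; lra.

Lemma between_real (R : realDomainType) (a b k : R) :
  `|a - k| + `|k - b| = `|a - b| -> (a <= k <= b) || (b <= k <= a).
Proof. abs_lra. Qed.

Lemma not_between_real (R : realDomainType) (a b k : R) :
  `|a - b| < `|a - k| + `|k - b| ->
  (a < k) && (b < k) || (k < a) && (k < b).
Proof. abs_lra. Qed.

(** Used in [span_le] to single out the edges that separate the first two points from the other two:
    only these can contribute more than twice their length. *)
Lemma same_side_real (R : realFieldType) (a b m n l : R) :
  0 <= a <= l -> 0 <= b <= l -> 0 <= m <= l -> 0 <= n <= l ->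
  2 * l < `|a - m| + `|b - m| + `|a - n| + `|b - n| ->
  [&& a < m, b < m, a < n & b < n] || [&& m < a, m < b, n < a & n < b].
Proof. abs_lra. Qed.

(** * Projection onto an edge *)

Section MetricTree.
Variables (R : realType) (T : metric_tree R).
Implicit Types (x y : mt_vertex T) (e f : mt_edge T) (p q c u w : mt_point T).

Definition adj_minus e x y : bool :=
  [&& mt_adj x y, (x, y) != val e & (y, x) != val e].

(** This is the nearest-point projection onto [e], read as a parameter of its interval. Deleting [e]
    leaves two components, each projecting to one end; another edge [f] stays whole inside one of
    them, so its inner points follow [mt_src f]. *)
Definition coord e p : R :=
  let side x := if connect (adj_minus e) (mt_src e) x then 0 else mt_len e in
  match p with
  | Vertex x => side x
  | Inner f t _ => if f == e then t else side (mt_src f)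
  end.

Lemma adj_sym : symmetric (@mt_adj R T).
Proof. by case: (mt_is_tree T). Qed.

Lemma adj_irr : irreflexive (@mt_adj R T).
Proof. by case: (mt_is_tree T). Qed.

Lemma adj_minus_sym e : symmetric (adj_minus e).
Proof. by move=> x y; rewrite /adj_minus adj_sym [X in _ && X]andbC. Qed.

Lemma edge_adj e : mt_adj (mt_src e) (mt_tgt e).
Proof. by case/andP: (valP e). Qed.

Lemma edge_rank e : (enum_rank (mt_src e) < enum_rank (mt_tgt e))%N.
Proof. by case/andP: (valP e). Qed.

Lemma edge_src_neq_tgt e : mt_src e != mt_tgt e.
Proof. by apply/eqP => h; have := edge_adj e; rewrite h adj_irr. Qed.

Lemma edge_of_adj x y : mt_adj x y ->
  exists e, val e = (x, y) \/ val e = (y, x).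
Proof.
pose P (z : mt_vertex T * mt_vertex T) :=
  mt_adj z.1 z.2 && (enum_rank z.1 < enum_rank z.2)%N.
move=> axy; case: (ltngtP (enum_rank x) (enum_rank y)) => h.
- have he : P (x, y) by rewrite /P /= axy.
  by exists (exist P _ he); left.
- have he : P (y, x) by rewrite /P /= adj_sym axy.
  by exists (exist P _ he); right.
- by move: axy; rewrite (enum_rank_inj (val_inj h)) adj_irr.
Qed.

Lemma edge_in_adj_minus e f : f != e -> adj_minus e (mt_src f) (mt_tgt f).
Proof.
move=> fe; rewrite /adj_minus edge_adj andTb; apply/andP; split.
  by rewrite -[X in X != _]surjective_pairing (inj_eq val_inj).
(* Rank order rules out that [f] is [e] reversed. *)
apply/eqP => h; have := edge_rank e.
by rewrite /mt_src /mt_tgt -h /= ltnNge ltnW // edge_rank.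
Qed.

(* A detour around [e] would close up with [e] into a cycle. *)
Lemma edge_separates e : ~~ connect (adj_minus e) (mt_src e) (mt_tgt e).
Proof.
apply/negP => /connectP[_ /shortenP[s hs us _] ls].
case: (mt_is_tree T) => _ _ _ _ /(_ (mt_src e :: s)) hc.
have hp : path (@mt_adj R T) (mt_src e) s.
  by apply: sub_path hs => x y /= /and3P[].
have /hc : ucycle (@mt_adj R T) (mt_src e :: s).
  by rewrite /ucycle us andbT /= rcons_path hp -ls adj_sym edge_adj.
case: s hs us ls {hp hc} => [|x [|//]] /=.
  by move=> _ _ h; have := edge_src_neq_tgt e; rewrite h eqxx.
move=> /andP[/and3P[_ + _] _] _ h _.
by rewrite -h -[X in X != _]surjective_pairing eqxx.
Qed.

Lemma coord_connect e x y :
  connect (adj_minus e) x y -> coord e (Vertex x) = coord e (Vertex y).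
Proof.
move=> h; rewrite /= (same_connect_r _ h) //.
exact/sym_connect_sym/adj_minus_sym.
Qed.

Lemma coord_on_edge e t p : on_edge e t p -> coord e p = t.
Proof.
case: p => [x|f s h] /=; last by case=> -> ->; rewrite eqxx.
case=> [[-> ->]|[-> ->]]; first by rewrite connect0.
by rewrite (negbTE (edge_separates e)).
Qed.

Lemma coord_off_edge e f t p :
  f != e -> on_edge f t p -> coord e p = coord e (Vertex (mt_src f)).
Proof.
move=> fe; case: p => [x|g s h].
  case=> [[-> _]//|[-> _]]; apply/esym/coord_connect/connect1.
  exact: edge_in_adj_minus.
by case=> gf _; rewrite /= gf (negbTE fe).
Qed.

Lemma coord_step e f s t p q : on_edge f s p -> on_edge f t q ->
  coord e p <> coord e q -> f = e.
Proof.
move=> hp hq; case: (eqVneq f e) => // fe.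
by rewrite (coord_off_edge fe hp) (coord_off_edge fe hq).
Qed.

(** The second clause lets [geodesic] reduce paths starting at inner points to paths starting at
    vertices. *)
Lemma point_at_coord e q : exists w,
  on_edge e (coord e q) w /\ (w = q \/ exists x, w = Vertex x).
Proof.
have hv x : exists w, on_edge e (coord e (Vertex x)) w /\
    (w = q \/ exists x', w = Vertex x').
  rewrite /=; case: ifP => _.
    by exists (Vertex (mt_src e)); split; [left|right; exists (mt_src e)].
  by exists (Vertex (mt_tgt e)); split; [right|right; exists (mt_tgt e)].
case: q hv => [x|f s h] hv; first exact: hv.
case: (eqVneq f e) => [fe|fe].
  exists (Inner h); split; last by left.
  by rewrite /= fe eqxx.
suff -> : coord e (Inner h) = coord e (Vertex (mt_src f)) by exact: hv.
by rewrite /= (negbTE fe).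
Qed.

Lemma coord_bounds e p : 0 <= coord e p <= mt_len e.
Proof.
have l0 := ltW (mt_len_gt0 e).
have hv x : 0 <= coord e (Vertex x) <= mt_len e.
  by rewrite /=; case: ifP => _; rewrite ?lexx l0.
case: p => [x|f s h]; first exact: hv.
move: (hv (mt_src f)) => /=; case: eqP => // fe _.
by subst f; case/andP: h => /ltW -> /ltW ->.
Qed.

Lemma coord_vertex e x :
  coord e (Vertex x) = 0 \/ coord e (Vertex x) = mt_len e.
Proof. by rewrite /=; case: ifP => _; [left|right]. Qed.

(** * The l1 distance of the projections *)

Definition tdist p q : R := \sum_e `|coord e p - coord e q|.

Lemma tdistC p q : tdist p q = tdist q p.
Proof. by apply: eq_bigr => e _; rewrite distrC. Qed.

Lemma tdistpp p : tdist p p = 0.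
Proof. by apply: big1 => e _; rewrite subrr normr0. Qed.

Lemma tdist_ge0 p q : 0 <= tdist p q.
Proof. exact: sumr_ge0. Qed.

Lemma tdist_triangle q p u : tdist p u <= tdist p q + tdist q u.
Proof.
by rewrite /tdist -big_split /=; apply: ler_sum => e _; exact: ler_distD.
Qed.

Lemma tdist_between p q u :
  tdist p q + tdist q u = tdist p u <->
  forall e, `|coord e p - coord e q| + `|coord e q - coord e u| =
            `|coord e p - coord e u|.
Proof.
rewrite /tdist -big_split /=; split=> [h e|h]; last by apply: eq_bigr.
(* The triangle defects of the edges are nonnegative and sum to 0. *)
apply/eqP; rewrite -subr_eq0; apply/eqP; move: e isT.
apply: psumr_eq0P => [e _|]; first by rewrite subr_ge0 ler_distD.
by rewrite big_split /= sumrN h subrr.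
Qed.

Lemma tdist_step e s t p q u : on_edge e s p -> on_edge e t q ->
  t = coord e u -> tdist p u = `|s - t| + tdist q u.
Proof.
move=> hp hq tu; rewrite /tdist (bigD1 e) //= [in RHS](bigD1 e) //=.
rewrite (coord_on_edge hp) (coord_on_edge hq) -tu subrr normr0 add0r.
congr (_ + _); apply: eq_bigr => f fe; rewrite eq_sym in fe.
by rewrite (coord_off_edge fe hp) (coord_off_edge fe hq).
Qed.

(** * Paths, geodesics and the path metric *)

Lemma path_length_cat p q u l m :
  path_length p q l -> path_length q u m -> path_length p u (l + m).
Proof.
move=> hpq; elim: hpq u m => [{}p|{}p q1 {}q e s t k hp hq1 _ ih] u m h.
  by rewrite add0r.
by rewrite -addrA; apply: path_cons hp hq1 (ih _ _ h).
Qed.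

Lemma path_length_sym p q l : path_length p q l -> path_length q p l.
Proof.
elim=> [{}p|{}p q1 {}q e s t k hp hq1 _ ih]; first exact: path_nil.
rewrite addrC; apply: path_length_cat ih _; rewrite distrC -[X in path_length _ _ X]addr0.
exact: path_cons hq1 hp (path_nil _).
Qed.

Lemma tdist_le_path p q l : path_length p q l -> tdist p q <= l.
Proof.
elim=> [{}p|{}p q1 {}q e s t k hp hq1 _ ih]; first by rewrite tdistpp.
apply: le_trans (tdist_triangle q1 _ _) _; apply: lerD => //.
by rewrite (tdist_step hp hq1) ?tdistpp ?addr0 ?(coord_on_edge hq1).
Qed.

Lemma vertex_geodesic x (s : seq (mt_vertex T)) :
  path (@mt_adj R T) x s -> uniq (x :: s) ->
  path_length (Vertex x) (Vertex (last x s))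
              (tdist (Vertex x) (Vertex (last x s))).
Proof.
elim: s x => [|y s ih] x /=; first by rewrite tdistpp => _ _; exact: path_nil.
move=> /andP[axy hs] /andP[xs us].
have [e he] := edge_of_adj axy.
have [[a ha] [b hb]] : (exists a, on_edge e a (Vertex x)) /\
                       (exists b, on_edge e b (Vertex y)).
  rewrite /= /mt_src /mt_tgt; case: he => -> /=.
    by split; [exists 0; left|exists (mt_len e); right].
  by split; [exists (mt_len e); right|exists 0; left].
(* The rest of the simple path never returns to [x], so it avoids [e] and its end projects to [b],
   like [y]. *)
have hc : b = coord e (Vertex (last y s)).
  rewrite -(coord_on_edge hb); apply/coord_connect/connectP; exists s => //.
  have hin : all (mem (y :: s)) (y :: s) by apply/allP.
  apply: (sub_in_path _ hin hs) => z z' /= zs z's azz'; rewrite /adj_minus azz' /=.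
  have zx : z != x by apply: contraNneq xs => <-.
  have z'x : z' != x by apply: contraNneq xs => <-.
  by case: he => ->; rewrite !xpair_eqE (negbTE zx) (negbTE z'x) ?andbF.
rewrite (tdist_step ha hb hc).
exact: path_cons ha hb (ih _ hs us).
Qed.

Lemma geodesic p q : path_length p q (tdist p q).
Proof.
have from_vertices u : (forall x, path_length (Vertex x) u (tdist (Vertex x) u)) ->
    forall v, path_length v u (tdist v u).
  move=> hu [x|e t h]; first exact: hu.
  have hp : on_edge e t (Inner h) by [].
  (* First walk along [e] to the projection of [u], which is [u] itself or a vertex. *)
  have [w [hw]] := point_at_coord e u.
  rewrite (tdist_step hp hw erefl) => wu; apply: path_cons hp hw _.
  case: wu => [->|[x ->]]; last exact: hu.
  by rewrite tdistpp; exact: path_nil.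
apply: (from_vertices) => x; rewrite tdistC; apply: path_length_sym.
apply: from_vertices => y.
case: (mt_is_tree T) => _ _ _ hc _.
have /connectP[_ /shortenP[s hs us _] ls] := hc y x.
by have := vertex_geodesic hs us; rewrite -ls.
Qed.

Lemma mt_distE p q : mt_dist p q = tdist p q.
Proof.
have hlb : lbound [set l | path_length p q l] (tdist p q).
  by move=> l /= /tdist_le_path.
apply/eqP; rewrite eq_le; apply/andP; split.
  by apply: ge_inf; [exists (tdist p q)|exact: geodesic].
by apply: lb_le_inf => //; exists (tdist p q); exact: geodesic.
Qed.

(** A discrete intermediate value theorem: the projection onto [e] moves only along segments of [e].
    Strictness matters, since points with equal projections can be joined without meeting [c]. *)
Lemma path_cut e s c p q l : path_length p q l -> on_edge e s c ->
  coord e p <= s -> s <= coord e q -> coord e p < coord e q ->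
  exists l1 l2, [/\ path_length p c l1, path_length c q l2 & l1 + l2 = l].
Proof.
move=> + hc; elim=> [{}p|{}p q1 {}q f a b k hp hq1 hq ih] ps sq pq.
  by rewrite ltxx in pq.
case: (boolP ((coord e q1 <= s) && (coord e q1 < coord e q))) => h.
  have [h1 h2] := andP h; have [l1 [l2 [H1 H2 <-]]] := ih h1 sq h2.
  exists (`|a - b| + l1), l2; split=> //; last by rewrite addrA.
  exact: path_cons hp hq1 H1.
(* Here the first segment already reaches or passes [s], so it runs along [e] through [c]. *)
have [sq1 pq1] : s <= coord e q1 /\ coord e p < coord e q1.
  by move: h; rewrite negb_and -ltNge -leNgt => /orP[] ?; split; lra.
have fe : f = e by apply: (coord_step hp hq1) => E; rewrite E ltxx in pq1.
subst f; rewrite (coord_on_edge hp) (coord_on_edge hq1) in ps sq1 pq1.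
exists (`|a - s| + 0), (`|s - b| + k); split.
- exact: path_cons hp hc (path_nil _).
- exact: path_cons hc hq1 hq.
abs_lra.
Qed.

Lemma tdist_cut e w p q : on_edge e (coord e w) w ->
  (coord e p <= coord e w <= coord e q) && (coord e p < coord e q) ||
  (coord e q <= coord e w <= coord e p) && (coord e q < coord e p) ->
  tdist p q = tdist p w + tdist w q.
Proof.
wlog: p q / (coord e p <= coord e w <= coord e q) && (coord e p < coord e q).
  move=> hw hon /orP[h|h]; first by apply: hw; rewrite ?h.
  by rewrite tdistC (hw q p) ?h // tdistC addrC (tdistC w p).
move=> /andP[/andP[pw wq] pq] hw _.
have [l1 [l2 [/tdist_le_path h1 /tdist_le_path h2 h]]] :=
  path_cut (geodesic p q) hw pw wq pq.
have := tdist_triangle w p q; lra.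
Qed.

(** * Points on geodesics and medians *)

Lemma point_on_edge e t : 0 <= t <= mt_len e -> exists c, on_edge e t c.
Proof.
case/andP; rewrite le_eqVlt => /predU1P[<- _|t0].
  by exists (Vertex (mt_src e)); left.
rewrite le_eqVlt => /predU1P[->|tl].
  by exists (Vertex (mt_tgt e)); right.
have h : 0 < t < mt_len e by rewrite t0.
by exists (Inner h).
Qed.

Lemma on_edge_bounds e t p : on_edge e t p -> 0 <= t <= mt_len e.
Proof. by move=> h; rewrite -(coord_on_edge h) coord_bounds. Qed.

Lemma path_point p q l t : path_length p q l -> 0 <= t <= l ->
  exists c, path_length p c t /\ path_length c q (l - t).
Proof.
move=> h; elim: h t => [{}p|{}p q1 {}q e a b k hp hq1 hq ih] t /andP[t0 tl].
  have -> : t = 0 by lra.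
  by exists p; rewrite subrr; split; exact: path_nil.
case: (leP t `|a - b|) => tab; last first.
  have ht : 0 <= t - `|a - b| <= k by apply/andP; split; lra.
  have [c [h1 h2]] := ih _ ht; exists c; split.
    by rewrite -[t](subrKC `|a - b|); apply: path_cons hp hq1 h1.
  by have -> : `|a - b| + k - t = k - (t - `|a - b|) by lra.
have /andP[a0 al] := on_edge_bounds hp; have /andP[b0 bl] := on_edge_bounds hq1.
have [s [sE1 sE2 sb]] : exists s, [/\ `|a - s| = t, `|s - b| = `|a - b| - t &
    0 <= s <= mt_len e].
  by case: (leP a b) => ab; [exists (a + t)|exists (a - t)]; split; abs_lra.
have [c hc] := point_on_edge sb.
exists c; split.
  by rewrite -sE1 -[X in path_length _ _ X]addr0; apply: path_cons hp hc (path_nil _).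
have -> : `|a - b| + k - t = `|s - b| + k by lra.
exact: path_cons hc hq1 hq.
Qed.

Lemma geodesic_point p q t : 0 <= t <= tdist p q ->
  exists c, tdist p c = t /\ tdist c q = tdist p q - t.
Proof.
move=> /(path_point (geodesic p q))[c [/tdist_le_path h1 /tdist_le_path h2]].
by exists c; have := tdist_triangle c p q; split; lra.
Qed.

(* If [c] is off the geodesic from [p] to [u], some edge witnesses it, and the
   point [w] of that edge closest to [c] lies on the geodesics from [c] to [p],
   from [c] to [u], and from [q] to [u]. Since [c] is between [p] and [q], it is
   then between [q] and [w]. *)
Lemma tdist_median p q c u : tdist p c + tdist c q = tdist p q ->
  tdist p c + tdist c u = tdist p u \/ tdist q c + tdist c u = tdist q u.
Proof.
move=> pcq; have [h|] := pselect (tdist p c + tdist c u = tdist p u); [by left|].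
move=> /tdist_between/existsNP[e /eqP he]; right.
have [w [hw _]] := point_at_coord e c.
have cw := coord_on_edge hw; rewrite -cw in hw he; have cut := tdist_cut hw.
have /not_between_real he' : `|coord e p - coord e u| <
    `|coord e p - coord e w| + `|coord e w - coord e u|.
  by rewrite lt_neqAle eq_sym he ler_distD.
have /between_real := (tdist_between p c q).1 pcq e; rewrite -cw => hb.
have pc : tdist p c = tdist p w + tdist w c.
  by apply: cut; rewrite -cw; case/orP: he'; lra.
have uc : tdist u c = tdist u w + tdist w c.
  by apply: cut; rewrite -cw; case/orP: he'; lra.
have qu : tdist q u = tdist q w + tdist w u.
  by apply: cut; case/orP: he'; case/orP: hb; lra.
have := tdist_triangle w p q; have := tdist_triangle c q u.
move: pc uc qu pcq; rewrite (tdistC c q) (tdistC c u) (tdistC w u) (tdistC w q).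
lra.
Qed.

(** * Lengths of spanned subtrees *)

Lemma perimeter_le p q u :
  tdist p q + tdist p u + tdist q u <= 2 * mt_size T.
Proof.
rewrite /tdist /mt_size -!big_split mulr_sumr /=; apply: ler_sum => e _.
(* Among three points of an interval, the pairwise distances sum to twice the largest one. *)
have := coord_bounds e p; have := coord_bounds e q; have := coord_bounds e u.
abs_lra.
Qed.

(* The left-hand sum is twice the length of the subtree spanned by the four
   points, unless [u] and [u'] branch off the geodesic from [p] to [q] at the
   same point. *)
Lemma span_le p q u u' :
  tdist p u - tdist q u <> tdist p u' - tdist q u' ->
  tdist p u + tdist q u + tdist p u' + tdist q u' <= 2 * mt_size T.
Proof.
move=> ne; rewrite /tdist /mt_size -!big_split mulr_sumr /=.
apply: ler_sum => e _; rewrite leNgt; apply/negP => lt; apply: ne.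
have /= := same_side_real (coord_bounds e p) (coord_bounds e q)
  (coord_bounds e u) (coord_bounds e u') lt.
wlog uu' : u u' {lt} / `|coord e p - coord e u| <= `|coord e p - coord e u'|.
  move=> hw; case: (leP `|coord e p - coord e u| `|coord e p - coord e u'|).
    exact: hw.
  by move=> /ltW /hw {}hw h; apply/esym/hw; lra.
(* This [w] lies on the geodesics from [p] and [q] to both [u] and [u'], so both differences equal
   [tdist p w - tdist q w]. *)
have [w [hw _]] := point_at_coord e u.
have cw := coord_on_edge hw; rewrite -cw in hw uu' *; have cut := tdist_cut hw.
move=> side.
have {uu' side} : [&& coord e p < coord e w, coord e q < coord e w &
                      coord e w <= coord e u'] ||
    [&& coord e w < coord e p, coord e w < coord e q &
        coord e u' <= coord e w] by case/orP: side => ?; abs_lra.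
by case/orP => side; rewrite (cut p u) ?(cut q u) ?(cut p u') ?(cut q u'); lra.
Qed.

(** * Diametral pairs and uncovered points *)

Lemma farthest_vertex x u :
  exists y, tdist (Vertex x) u <= tdist (Vertex x) (Vertex y).
Proof.
case: u => [y|e t h]; first by exists y.
have hp : on_edge e t (Inner h) by [].
have /andP[t0 tl] := on_edge_bounds hp.
(* A vertex projects to an end of [e]; sliding [u] to the opposite end changes no other coordinate.
   A maximum over the finitely many vertex pairs is thus a diameter. *)
have [y [s [hy hs]]] : exists y s, on_edge e s (Vertex y) /\
    `|coord e (Vertex x) - t| <= `|coord e (Vertex x) - s|.
  have hl := mt_len_gt0 e; case: (coord_vertex e x) => ->.
    by exists (mt_tgt e), (mt_len e); split; [right|abs_lra].
  by exists (mt_src e), 0; split; [left|abs_lra].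
exists y; apply: ler_sum => f _; case: (eqVneq e f) => [<-|ef].
  by rewrite (coord_on_edge hp) (coord_on_edge hy).
by rewrite (coord_off_edge ef hp) (coord_off_edge ef hy).
Qed.

Lemma diametral_pair : exists p q,
  forall u, tdist p u <= tdist p q /\ tdist q u <= tdist p q.
Proof.
case: (mt_is_tree T) => /card_gt0P[x0 _] _ _ _ _.
case: (@arg_maxP _ R _ (x0, x0) xpredT
  (fun z => tdist (Vertex z.1) (Vertex z.2)) isT) => [[x y] _ /= hmax].
exists (Vertex x), (Vertex y) => u; split.
  by have [z hz] := farthest_vertex x u; apply: le_trans hz (hmax (x, z) isT).
by have [z hz] := farthest_vertex y u; apply: le_trans hz (hmax (y, z) isT).
Qed.

Lemma is_cover2 (r1 r2 : R) c1 c2 : 0 <= r1 -> 0 <= r2 ->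
  (forall u, tdist c1 u <= r1 \/ tdist c2 u <= r2) -> is_cover T [:: r1; r2].
Proof.
move=> r10 r20 h; split.
  by move=> r; rewrite !inE => /orP[] /eqP ->.
exists (fun i => if val i == 0%N then c1 else c2).
apply/esym; rewrite -subTset => u _.
by case: (h u) => hu; [exists ord0|exists ord_max] => //;
  rewrite /mt_ball /= mt_distE.
Qed.

(** By [tdist_median], each centre lies on the geodesic from [p] or from [q] to [u]. For [c2] the
    end [q] would give [tdist q u > tdist p q], and for [c1] so would [p]; the remaining ends give
    the bounds. *)
Lemma diametral_uncovered p q c1 c2 u (r1 r2 : R) :
  tdist p u <= tdist p q -> tdist q u <= tdist p q ->
  tdist p c2 = r2 -> tdist c2 q = tdist p q - r2 ->
  tdist q c1 = r1 -> tdist c1 p = tdist p q - r1 ->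
  r1 < tdist c1 u -> r2 < tdist c2 u ->
  2 * r2 < tdist p u /\ 2 * r1 < tdist q u.
Proof.
move=> pu qu h1 h2 h3 h4 u1 u2.
have c2b : tdist p c2 + tdist c2 q = tdist p q by lra.
have c1b : tdist q c1 + tdist c1 p = tdist q p by rewrite (tdistC q p); lra.
have := tdist_median u c2b; have := tdist_median u c1b.
rewrite (tdistC q c2) (tdistC p c1).
by move=> [] ? [] ?; split; lra.
Qed.

End MetricTree.

Theorem theorem6p4 (R : realType) (r1 r2 : R) (T : metric_tree R) :
  0 <= r1 -> r1 <= r2 / 2 ->
  mt_size T <= 2 * (r1 + r2) ->
  is_cover T [:: r1; r2].
Proof.
move=> r10 r12 hT; have r20 : 0 <= r2 by lra.
have [p [q hpq]] := diametral_pair T.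
have D0 := tdist_ge0 p q.
case: (leP (tdist p q) (2 * r2)) => D2.
  have [|c [h1 h2]] := @geodesic_point _ _ p q (tdist p q / 2); first lra.
  (* The larger ball suffices, so the smaller one is put at the same centre. *)
  apply: (@is_cover2 _ _ r1 r2 c c) => // u; right.
  have hc : tdist p c + tdist c q = tdist p q by lra.
  have [pu qu] := hpq u; have := tdist_median u hc; rewrite (tdistC q c).
  by case; lra.
(* Stated for a general pair so that it serves both placements of the centres. *)
have uncovered (p' q' : mt_point T) : tdist p' q' = tdist p q ->
    (forall u, tdist p' u <= tdist p q /\ tdist q' u <= tdist p q) ->
    ~ is_cover T [:: r1; r2] ->
    exists u, 2 * r2 < tdist p' u /\ 2 * r1 < tdist q' u.
  move=> E h nc.
  have [|c2 [h1 h2]] := @geodesic_point _ _ p' q' r2; first lra.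
  have [|c1 [h3 h4]] := @geodesic_point _ _ q' p' r1.
    by rewrite tdistC; lra.
  rewrite (tdistC q' p') in h4.
  have [u hu] : exists u, ~ (tdist c1 u <= r1 \/ tdist c2 u <= r2).
    by apply/existsNP => hcov; apply: nc; exact: (is_cover2 r10 r20 hcov).
  have [u1 u2] : r1 < tdist c1 u /\ r2 < tdist c2 u.
    by split; rewrite ltNge; apply/negP => ?; apply: hu; [left|right].
  exists u; have [pu qu] := h u; rewrite -E in pu qu.
  exact: diametral_uncovered pu qu h1 h2 h3 h4 u1 u2.
have [//|nc] := pselect (is_cover T [:: r1; r2]); exfalso.
have [u [pu qu]] := uncovered p q erefl hpq nc.
have [|v [qv pv]] := uncovered q p (tdistC q p) _ nc.
  by move=> v; have [] := hpq v.
have := perimeter_le p q u; have := perimeter_le p q v.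
(* Equality means a common branch point: one of the two perimeters then exceeds [6 * r2], whereas
   [2 * mt_size T <= 4 * (r1 + r2) <= 6 * r2]. *)
have [E|/span_le] := pselect (tdist p u - tdist q u = tdist p v - tdist q v).
  lra.
lra.
Qed.
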